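(* Let $R$ be a commutative ring and $n\geq0$. For every set composition $\mathbf{A}\vDash\mathbb{N}_{n}$ we have $\mathrm{F}_{\mathbf{A}}=\mathrm{F}_{\operatorname{sz}(\mathbf{A})}^{\rho(\mathbf{A})}$. The family $\{\mathrm{F}_{\mathbf{A}}\}_{\mathbf{A}\vDash\mathbb{N}_{n}}$ is a basis of the degree $n$ part of $\mathtt{NCQSym}$, and it lifts the ordered Bell identity $\sum_{\ell=1}^{n}\ell!S(n,\ell)=\sum_{\sigma\in S_{n}}2^{|\operatorname{Des}(\sigma)|}$ (for $n\geq1$), in the sense that this basis is the disjoint union over $\sigma\in S_{n}$ of subsets such that the one corresponding to $\sigma$ has size $2^{|\operatorname{Des}(\sigma)|}$. For $n\geq1$ the ordered Bell number satisfies $\sum_{\ell=1}^{n}\ell!S(n,\ell)\leq2^{n-1}n!$, and the inequality is strict when $n\geq2$.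
   Context: Put $\mathbb{N}_{n}=\{1,\ldots,n\}$. $S(n,\ell)$ is the Stirling number of the second kind, $S_{n}$ is the symmetric group, and $\operatorname{Des}(\sigma)=\{k\in\mathbb{N}_{n-1}\;|\;\sigma(k)>\sigma(k+1)\}$ is the descent set of $\sigma\in S_{n}$. A composition $\alpha\vDash n$ is a finite sequence $(\alpha_{1},\ldots,\alpha_{\ell})$ of positive integers summing to $n$; $\beta\preceq\alpha$ means that $\beta$ refines $\alpha$, i.e., $\beta$ is the concatenation, in order, of compositions of $\alpha_{1},\ldots,\alpha_{\ell}$. A set composition $\mathbf{A}=(A_{1},\ldots,A_{\ell})\vDash\mathbb{N}_{n}$ is an ordered collection of non-empty pairwise disjoint sets with union $\mathbb{N}_{n}$; $\ell(\mathbf{A})=\ell$ and $\operatorname{sz}(\mathbf{A})=(|A_{1}|,\ldots,|A_{\ell}|)\vDash n$. For set compositions of $\mathbb{N}_{n}$, $\mathbf{B}\preceq\mathbf{A}$ means that each set of $\mathbf{A}$ is the union of sets of $\mathbf{B}$ appearing consecutively, in the order of $\mathbf{A}$. We write $\mathbf{B}\preceq_{*}\mathbf{A}$ if $\mathbf{B}\preceq\mathbf{A}$ and, whenever two consecutive sets $B_{j},B_{j+1}$ of $\mathbf{B}$ are both contained in the same set of $\mathbf{A}$, all elements of $B_{j}$ are smaller than all elements of $B_{j+1}$. For $\rho\in S_{n}$ let $\mathbf{B}_{\rho}=(\{\rho(1)\},\ldots,\{\rho(n)\})$. For every $\mathbf{A}\vDash\mathbb{N}_{n}$, $\rho(\mathbf{A})$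 is the unique element of $S_{n}$ with $\mathbf{B}_{\rho(\mathbf{A})}\preceq_{*}\mathbf{A}$. For $\alpha\vDash n$ and $\rho\in S_{n}$, $\mathbf{A}_{\alpha}^{\rho}$ is the set composition with $\operatorname{sz}(\mathbf{A}_{\alpha}^{\rho})=\alpha$ and $\mathbf{B}_{\rho}\preceq\mathbf{A}_{\alpha}^{\rho}$, i.e., its $j$th set is $\{\rho(k)\;|\;\alpha_{1}+\cdots+\alpha_{j-1}<k\leq\alpha_{1}+\cdots+\alpha_{j}\}$. In the ring of power series over $R$ in non-commuting variables $x_{1},x_{2},\ldots$, for $\mathbf{A}\vDash\mathbb{N}_{n}$ of length $\ell$ and $I=\{i_{1}<\cdots<i_{\ell}\}\subseteq\mathbb{N}$, let $x_{I}^{\mathbf{A}}=x_{\eta_{1}}\cdots x_{\eta_{n}}$, where $\eta_{k}=i_{j}$ if $k\in A_{j}$, and $\mathrm{M}_{\mathbf{A}}=\sum_{|I|=\ell}x_{I}^{\mathbf{A}}$. The degree $n$ part of $\mathtt{NCQSym}$ is the free $R$-module with basis $\{\mathrm{M}_{\mathbf{A}}\}_{\mathbf{A}\vDash\mathbb{N}_{n}}$. Set $\mathrm{M}_{\alpha}^{\rho}=\mathrm{M}_{\mathbf{A}_{\alpha}^{\rho}}$, $\mathrm{F}_{\alpha}^{\rho}=\sum_{\beta\preceq\alpha}\mathrm{M}_{\beta}^{\rho}$, and $\mathrm{F}_{\mathbf{A}}=\sum_{\mathbf{B}\preceq_{*}\mathbf{A}}\mathrm{M}_{\mathbf{B}}$.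 *)

(* Defs.v *)
(* Indices are shifted by one: N_n = {1, ..., n} is 'I_n = {0, ..., n-1}, and
   the variable x_{i+1} is represented by the letter i : nat. *)
From HB Require Import structures.
From mathcomp Require Import all_boot all_order all_algebra all_fingroup.
From mathcomp Require Import finmap.
From mathcomp Require Import boolp classical_sets functions cardinality fsbigop.
(* so that set0, setT, ... are those of {set T} *)
From mathcomp Require Import finset.

Set Implicit Arguments.
Unset Strict Implicit.
Unset Printing Implicit Defensive.

Import GRing.Theory.

Definition is_intcomp (n : nat) (s : seq nat) : bool :=
  all (ltn 0) s && (sumn s == n).

Record intcomp (n : nat) : Type :=
  IntComp { parts :> seq nat; intcompP : is_intcomp n parts }.

HB.instance Definition _ n := [isSub for @parts n].
HB.instance Definition _ n := [Choice of intcomp n by <:].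
HB.instance Definition _ n := [Countable of intcomp n by <:].

Section IntcompFinite.
Variable n : nat.

Definition intcomp_enc (a : intcomp n) : n.-bseq 'I_n.+1 :=
  insub_bseq n [seq inord k | k <- parts a].

Definition intcomp_dec (b : n.-bseq 'I_n.+1) : option (intcomp n) :=
  insub [seq val k | k <- b].

Lemma intcomp_encK : pcancel intcomp_enc intcomp_dec.
Proof.
move=> a; have /andP[apos /eqP asum] := intcompP a.
have size_a : size (parts a) <= n.
  rewrite -[leqRHS]asum; elim: (parts a) apos => //= k s IHs /andP[k_gt0 s_gt0].
  by rewrite -[(size s).+1]add1n leq_add ?IHs.
have a_le : {in parts a, forall k, k < n.+1}.
  move=> k ka; rewrite ltnS -[leqRHS]asum; elim: (parts a) ka => //= k' s IHs.
  rewrite inE => /predU1P[<-|/IHs]; first exact: leq_addr.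
  by move=> /leq_trans -> //; exact: leq_addl.
rewrite /intcomp_dec /intcomp_enc /insub_bseq insubdK ?unfold_in ?size_map //.
rewrite -map_comp (_ : [seq _ | k <- _] = parts a) ?valK //.
by rewrite -[RHS]map_id; apply/eq_in_map => k /a_le k_lt /=; rewrite inordK.
Qed.

HB.instance Definition _ : isFinite (intcomp n) := PCanIsFinite intcomp_encK.

End IntcompFinite.

Definition intcomp_refines (n : nat) (b a : intcomp n) : Prop :=
  exists2 ss : seq (seq nat), flatten ss = parts b & [seq sumn s | s <- ss] = parts a.

Definition is_setcomp (n : nat) (s : seq {set 'I_n}) : bool :=
  [&& set0 \notin s,
      pairwise (fun X Y : {set 'I_n} => [disjoint X & Y]) s &
      \bigcup_(X <- s) X == [set: 'I_n]].

Record setcomp (n : nat) : Type :=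
  SetComp { blocks :> seq {set 'I_n}; setcompP : is_setcomp blocks }.

HB.instance Definition _ n := [isSub for @blocks n].
HB.instance Definition _ n := [Choice of setcomp n by <:].
HB.instance Definition _ n := [Countable of setcomp n by <:].

Section SetcompBasics.
Variable n : nat.
Implicit Types (s : seq {set 'I_n}) (A : setcomp n) (ss : seq (seq 'I_n)).

Lemma uniq_flatten_enum s :
  pairwise (fun X Y : {set 'I_n} => [disjoint X & Y]) s ->
  uniq (flatten [seq enum X | X : {set 'I_n} <- s]).
Proof.
elim: s => //= X s IHs /andP[/allP Xs /IHs us].
rewrite cat_uniq enum_uniq us andbT /=; apply/hasPn => x.
case/flatten_mapP=> Y /Xs; rewrite disjoint_sym => dYX.
rewrite mem_enum => /(disjointFr dYX) xX.
by rewrite /= mem_enum xX.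
Qed.

Lemma mem_bigcup_seq s x : (x \in \bigcup_(X <- s) X) = has (fun X : {set 'I_n} => x \in X) s.
Proof. by elim: s => [|X s IHs]; rewrite ?big_nil ?big_cons !inE //= IHs. Qed.

Lemma perm_flatten_enum A :
  perm_eq (flatten [seq enum X | X : {set 'I_n} <- blocks A]) (enum 'I_n).
Proof.
have /and3P[_ /uniq_flatten_enum uA /eqP covA] := setcompP A.
apply: uniq_perm; rewrite ?enum_uniq // => x; rewrite mem_enum.
have : x \in \bigcup_(X <- A) X by rewrite covA inE.
rewrite mem_bigcup_seq => /hasP[X XA xX]; rewrite inE.
by apply/flatten_mapP; exists X; rewrite ?mem_enum.
Qed.

Lemma setcomp_sumn A : sumn [seq #|X| | X : {set 'I_n} <- blocks A] = n.
Proof.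
rewrite -[RHS]card_ord cardE -(perm_size (perm_flatten_enum A)) size_flatten.
by rewrite /shape -map_comp; congr sumn; apply: eq_map => X /=; rewrite cardE.
Qed.

Lemma sz_subproof A : is_intcomp n [seq #|X| | X : {set 'I_n} <- blocks A].
Proof.
rewrite /is_intcomp setcomp_sumn eqxx andbT all_map; apply/allP => X XA /=.
rewrite card_gt0; have /andP[A0 _] := setcompP A.
by apply: contraNneq A0 => <-.
Qed.

Definition sz A : intcomp n := IntComp (sz_subproof A).

Definition setcomp_enc A : n.-bseq {set 'I_n} := insub_bseq n (blocks A).

Definition setcomp_dec (b : n.-bseq {set 'I_n}) : option (setcomp n) :=
  insub (bseqval b).

Lemma setcomp_encK : pcancel setcomp_enc setcomp_dec.
Proof.
move=> A; rewrite /setcomp_dec /setcomp_enc /insub_bseq insubdK ?valK //.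
rewrite unfold_in -[leqRHS](setcomp_sumn A); have /andP[+ _] := sz_subproof A.
elim: (blocks A) => //= X s IHs /andP[X_gt0 /IHs s_le].
by rewrite -[(size s).+1]add1n leq_add.
Qed.

HB.instance Definition _ : isFinite (setcomp n) := PCanIsFinite setcomp_encK.

Lemma is_setcomp_flatten ss :
  [::] \notin ss -> perm_eq (flatten ss) (enum 'I_n) ->
  is_setcomp [seq [set x in t] | t : seq 'I_n <- ss].
Proof.
move=> ss0 ss_perm; apply/and3P; split.
- apply/mapP => -[[|x t] t_ss /setP t0]; first by rewrite t_ss in ss0.
  by have := t0 x; rewrite !inE eqxx.
- have : uniq (flatten ss) by rewrite (perm_uniq ss_perm) enum_uniq.
  elim: ss {ss0 ss_perm} => //= t ss IHss; rewrite cat_uniq.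
  case/and3P=> _ /hasPn t_ss /IHss ->; rewrite andbT.
  apply/allP => _ /mapP[u u_ss ->]; rewrite disjoint_sym.
  apply/pred0Pn => -[x /=]; rewrite !inE => /andP[xu]; apply/negP/t_ss.
  by apply/flattenP; exists u.
- apply/eqP/setP => x; rewrite mem_bigcup_seq inE.
  have : x \in flatten ss by rewrite (perm_mem ss_perm) mem_enum.
  by case/flattenP=> t t_ss xt; apply/hasP; exists [set y in t];
    rewrite ?inE // map_f.
Qed.

Implicit Types (rho : 'S_n) (al : intcomp n).

Definition one_line rho : seq 'I_n := [seq rho k | k <- enum 'I_n].

Lemma perm_one_line rho : perm_eq (one_line rho) (enum 'I_n).
Proof.
apply: uniq_perm; rewrite ?enum_uniq //.
  by rewrite (map_inj_uniq (@perm_inj _ rho)) enum_uniq.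
by move=> x; rewrite mem_enum -[x](permKV rho) map_f // mem_enum.
Qed.

Lemma size_one_line rho : size (one_line rho) = n.
Proof. by rewrite size_map size_enum_ord. Qed.

Lemma singletons_subproof rho : is_setcomp [seq [set x] | x <- one_line rho].
Proof.
rewrite (_ : map _ _ = [seq [set x in t] | t <- [seq [:: x] | x <- one_line rho]]).
  by apply: is_setcomp_flatten; rewrite ?flatten_seq1 ?perm_one_line //; apply/mapP => -[].
by rewrite -[RHS]map_comp; apply: eq_map => x /=; apply/setP => y; rewrite !inE.
Qed.

(* B_rho *)
Definition singletons rho : setcomp n := SetComp (singletons_subproof rho).

Lemma cut_subproof al rho :
  is_setcomp [seq [set x in t] | t : seq 'I_n <- reshape (parts al) (one_line rho)].
Proof.
have /andP[al_gt0 /eqP al_sum] := intcompP al.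
have size_al : size (one_line rho) = sumn (parts al) by rewrite al_sum size_one_line.
apply: is_setcomp_flatten; last by rewrite reshapeKr ?perm_one_line // size_al.
apply: contraL al_gt0 => al0; rewrite -has_predC; apply/hasP; exists 0 => //.
by rewrite -(reshapeKl (eq_leq (esym size_al))); apply/mapP; exists [::].
Qed.

(* A_alpha^rho: the word rho(1) ... rho(n) is cut into consecutive factors of
   lengths alpha_1, alpha_2, ... *)
Definition cut al rho : setcomp n := SetComp (cut_subproof al rho).

Definition setcomp_refines (B A : setcomp n) : Prop :=
  exists2 ss : seq (seq {set 'I_n}), flatten ss = blocks B &
    [seq \bigcup_(X <- s) X | s <- ss] = blocks A.

Definition setcomp_refines_star (B A : setcomp n) : Prop :=
  setcomp_refines B A /\
  forall (j : nat) (X : {set 'I_n}), j.+1 < size B -> X \in blocks A ->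
    nth set0 B j \subset X -> nth set0 B j.+1 \subset X ->
    forall x y : 'I_n, x \in nth set0 B j -> y \in nth set0 B j.+1 -> x < y.

Lemma one_line_inj : injective one_line.
Proof.
by move=> r1 r2 /eq_in_map r12; apply/permP => k; apply: r12; rewrite mem_enum.
Qed.

Lemma one_line_onto (s : seq 'I_n) : perm_eq s (enum 'I_n) -> exists rho, one_line rho = s.
Proof.
move=> s_perm; have s_size : size s = n by rewrite (perm_size s_perm) size_enum_ord.
have s_uniq : uniq s by rewrite (perm_uniq s_perm) enum_uniq.
have f_inj : injective (fun k : 'I_n => nth k s k).
  move=> i j; rewrite (set_nth_default i j) ?s_size // => /eqP.
  by rewrite nth_uniq ?s_size // => /eqP /val_inj.
exists (perm f_inj); case: (posnP n) => [n0|n_gt0].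
  by rewrite (size0nil (etrans (size_one_line _) n0)) (size0nil (etrans s_size n0)).
pose x0 := Ordinal n_gt0; apply: (@eq_from_nth _ x0); rewrite size_one_line // => i i_lt.
rewrite (nth_map x0) ?size_enum_ord // permE nth_enum_ord //.
by apply: set_nth_default; rewrite s_size.
Qed.

Lemma sorted_enum_set (X : {set 'I_n}) : sorted (fun x y : 'I_n => x < y) (enum X).
Proof.
rewrite (_ : enum X = [seq x <- enum 'I_n | x \in X]); last first.
  by rewrite {1}/enum_mem -enumT.
apply: sorted_filter => [? ? ?|]; first exact: ltn_trans.
have -> : (fun x y : 'I_n => x < y) = relpre val ltn by [].
by rewrite -sorted_map val_enum_ord iota_ltn_sorted.
Qed.

Lemma bigcup_singletons (t : seq 'I_n) :
  \bigcup_(X <- [seq [set x] | x <- t]) X = [set x in t].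
Proof.
apply/setP => y; rewrite mem_bigcup_seq !inE has_map.
apply/hasP/idP => [[x xt /=]|yt]; first by rewrite inE => /eqP ->.
by exists y; rewrite /= ?inE.
Qed.

Lemma pairwise_flatten_enum A :
  pairwise (fun x y : 'I_n => all (fun X : {set 'I_n} =>
      (x \in X) && (y \in X) ==> (x < y)) (blocks A))
    (flatten [seq enum X | X : {set 'I_n} <- blocks A]).
Proof.
have /and3P[_ + _] := setcompP A.
set e := fun x y : 'I_n => _; move: (blocks A) @e => s e s_disj.
have e_enum (X : {set 'I_n}) : X \in s -> pairwise e (enum X).
  move=> Xs; apply: (sub_in_pairwise (P := [in X]) (r := fun x y => x < y)).
  - move=> x y xX yX xy; apply/allP => Y Ys; apply/implyP; by [].
  - by apply/allP => x; rewrite mem_enum.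
  - by rewrite -sorted_pairwise ?sorted_enum_set // => ? ? ?; exact: ltn_trans.
have e_cross (X Y : {set 'I_n}) : X \in s -> Y \in s -> [disjoint X & Y] ->
    allrel e (enum X) (enum Y).
  move=> Xs Ys XY; apply/allrelP => x y; rewrite !mem_enum => xX yY.
  apply/allP => Z Zs; apply/implyP => /andP[xZ yZ].
  have dsj (U V : {set 'I_n}) z : U \in s -> V \in s -> z \in U -> z \in V -> U = V.
    move=> /(nthP set0)[i i_lt <-] /(nthP set0)[j j_lt <-] zi zj.
    case: (ltngtP i j) => [ij|ji|-> //].
    + have := pairwiseP set0 s_disj i j i_lt j_lt ij.
      by move/disjointFr/(_ zi); rewrite zj.
    + have := pairwiseP set0 s_disj j i j_lt i_lt ji.
      by move/disjointFr/(_ zj); rewrite zi.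
  have XYe : X = Y by rewrite (dsj X Z x) // (dsj Y Z y).
  by have := disjointFr XY xX; rewrite -XYe xX.
have {e_enum e_cross} e_flat r : {subset r <= s} ->
    pairwise (fun X Y : {set 'I_n} => [disjoint X & Y]) r ->
    pairwise e (flatten [seq enum X | X : {set 'I_n} <- r]).
  elim: r => //= X r IHr rs /andP[/allP Xr r_disj].
  have Xs : X \in s by rewrite rs ?inE ?eqxx.
  have {}rs : {subset r <= s} by move=> Y Yr; rewrite rs // inE Yr orbT.
  rewrite pairwise_cat e_enum // IHr // !andbT.
  apply/allrelP => x y xX /flatten_mapP[Y Yr yY].
  exact: (allrelP (e_cross X Y Xs (rs _ Yr) (Xr _ Yr))).
exact: e_flat.
Qed.

Lemma singletons_refines_starP rho A :
  setcomp_refines_star (singletons rho) A <->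
  one_line rho = flatten [seq enum X | X : {set 'I_n} <- blocks A].
Proof.
split=> [[[ss ss_flat ss_cup] star]|rhoE].
- pose tt := reshape (shape ss) (one_line rho).
  have ss_tt : ss = [seq [seq [set x] | x <- t] | t <- tt].
    by rewrite map_reshape -[[seq _ | _ <- one_line rho]]ss_flat flattenK.
  have tt_flat : flatten tt = one_line rho.
    apply: reshapeKr; rewrite -size_flatten ss_flat.
    by rewrite [leqRHS]size_map.
  rewrite -ss_cup -{1}tt_flat; congr flatten.
  rewrite ss_tt -!map_comp -[LHS]map_id; apply/eq_in_map => t t_tt /=.
  rewrite bigcup_singletons.
  apply: (@irr_sorted_eq _ (fun x y : 'I_n => x < y)).
  + by move=> ? ? ?; exact: ltn_trans.
  + by move=> x; exact: ltnn.
  + have [tt1 [tt2 ttE]] : exists tt1 tt2, tt = tt1 ++ t :: tt2.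
      by case/splitPr: t_tt => tt1 tt2; exists tt1, tt2.
    have lineE : one_line rho = flatten tt1 ++ t ++ flatten tt2.
      by rewrite -tt_flat ttE flatten_cat.
    case: t t_tt ttE lineE => // x0 t' t_tt ttE lineE; set t := x0 :: t' in t_tt ttE lineE *.
    apply/(sortedP x0) => i i_lt. have i_lt1 := ltnW i_lt.
    have nthE k : k < size t ->
        nth set0 (singletons rho) (size (flatten tt1) + k) = [set nth x0 t k].
      move=> k_lt; rewrite [LHS](nth_map x0) lineE; last first.
        by rewrite !size_cat ltn_add2l ltn_addr.
      by rewrite nth_cat ltnNge leq_addr addKn nth_cat k_lt.
    have XA : [set x in t] \in blocks A.
      by rewrite -ss_cup ss_tt -bigcup_singletons -map_comp; apply/mapP; exists t.
    apply: (star (size (flatten tt1) + i) _ _ XA).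
    * by rewrite /= size_map lineE !size_cat -addnS ltn_add2l ltn_addr.
    * by rewrite nthE // sub1set inE mem_nth.
    * by rewrite -addnS nthE // sub1set inE mem_nth.
    * by rewrite nthE // inE.
    * by rewrite -addnS nthE // inE.
  + exact: sorted_enum_set.
  + by move=> x; rewrite mem_enum inE.
- split.
    exists [seq [seq [set x] | x <- enum X] | X : {set 'I_n} <- blocks A].
      by rewrite /= rhoE map_flatten -map_comp.
    rewrite -map_comp -[RHS]map_id; apply: eq_map => X /=.
    by rewrite bigcup_singletons; apply/setP => x; rewrite inE mem_enum.
  move=> j X; rewrite [size _]size_map => j_lt XA.
  have x0 : 'I_n by move: j_lt; rewrite size_one_line => /ltnW j_lt; exact: Ordinal j_lt.
  have nthE k : k < size (one_line rho) ->
      nth set0 [seq [set x] | x <- one_line rho] k = [set nth x0 (one_line rho) k].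
    exact: nth_map.
  rewrite !nthE ?(ltnW j_lt) // !sub1set => jX jX' x y.
  rewrite !inE => /eqP -> /eqP ->.
  have := pairwiseP x0 (pairwise_flatten_enum A) j j.+1; rewrite -rhoE.
  move=> /(_ (ltnW j_lt) j_lt (ltnSn j)) /allP /(_ X XA).
  by rewrite jX jX'.
Qed.

Lemma rho_exists_unique A :
  exists! rho : 'S_n, setcomp_refines_star (singletons rho) A.
Proof.
have [rho rhoE] := one_line_onto (perm_flatten_enum A).
exists rho; split=> [|r]; first exact/singletons_refines_starP.
by move/singletons_refines_starP; rewrite -rhoE => /one_line_inj.
Qed.

Definition rho_of A : 'S_n := projT1 (cid (rho_exists_unique A)).

Lemma rho_ofP A : setcomp_refines_star (singletons (rho_of A)) A.
Proof. by have [] := projT2 (cid (rho_exists_unique A)). Qed.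

Lemma rho_of_uniq A rho : setcomp_refines_star (singletons rho) A -> rho_of A = rho.
Proof. by have [_] := projT2 (cid (rho_exists_unique A)); apply. Qed.

End SetcompBasics.

Local Open Scope ring_scope.

(* A power series in x_1, x_2, ... over R, as its function of coefficients:
   the monomials are the words. *)
Notation ncseries R := (seq nat -> R^o) (only parsing).

(* The monomial x_I^A, for I with as many elements as A has blocks. *)
Definition ncmonomial (n : nat) (A : setcomp n) (I : {fset nat}) : seq nat :=
  [seq nth 0%N (sort leq (enum_fset I))
         (find (fun X : {set 'I_n} => k \in X) (blocks A)) | k <- enum 'I_n].

Lemma mem_ncmonomial (n : nat) (A : setcomp n) (I : {fset nat}) :
  #|` I| = size (blocks A) -> ncmonomial A I =i I.
Proof.
move=> I_size; have /and3P[A0 A_disj /eqP A_cov] := setcompP A.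
have s_size : size (sort leq (enum_fset I)) = size (blocks A).
  by rewrite size_sort -I_size.
have memI i : (i \in I) = (i \in sort leq (enum_fset I)) by rewrite mem_sort.
move=> i; rewrite memI; apply/mapP/(nthP 0%N) => [[k _ ->]|[j]].
  exists (find (fun X : {set 'I_n} => k \in X) (blocks A)) => //.
  rewrite s_size -has_find -mem_bigcup_seq.
  by have := finset.in_setT k; rewrite -A_cov.
rewrite s_size => j_lt <-; have Xj := mem_nth finset.set0 j_lt.
have [X0|[k kX]] := set_0Vmem (nth finset.set0 (blocks A) j).
  by rewrite -X0 Xj in A0.
exists k; first by rewrite mem_enum.
set p := fun X : {set 'I_n} => k \in X; congr (nth _ _ _).
have p_has : has p (blocks A).
  by apply/hasP; exists (nth finset.set0 (blocks A) j).
have := nth_find finset.set0 p_has; rewrite has_find in p_has.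
case: (ltngtP j (find p (blocks A))) => // [j_lt_f|f_lt_j] pf.
  by have := before_find finset.set0 j_lt_f; rewrite /p kX.
have := pairwiseP finset.set0 A_disj _ _ p_has j_lt f_lt_j.
by move/disjointFr/(_ pf); rewrite kX.
Qed.

Lemma ncmonomial_inj (n : nat) (A : setcomp n) :
  {in [pred I : {fset nat} | #|` I| == size (blocks A)] &, injective (ncmonomial A)}.
Proof.
move=> I J /eqP I_size /eqP J_size IJ; apply/fsetP => i.
by rewrite -(mem_ncmonomial I_size) IJ mem_ncmonomial.
Qed.

Section NCQSym.
Variables (R : comPzRingType) (n : nat).
Implicit Types (A B : setcomp n) (al be : intcomp n) (rho : 'S_n).

(* By ncmonomial_inj, at most one I contributes to the coefficient of w, so the
   finitely supported sum never takes its default value. *)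
Definition ncM A : ncseries R := fun w =>
  \sum_(I \in [set I : {fset nat} | #|` I| = size (blocks A)]%classic)
    ((ncmonomial A I == w)%:R : R).

(* The degree n part of NCQSym: the R-span of the M_A. *)
Definition ncqsym : set (ncseries R) :=
  [set f | exists c : setcomp n -> R, f = \sum_(A : setcomp n) c A *: ncM A]%classic.

Definition ncM_cut al rho : ncseries R := ncM (cut al rho).

Definition ncF_cut al rho : ncseries R :=
  \sum_(be : intcomp n | `[< intcomp_refines be al >]) ncM_cut be rho.

Definition ncF A : ncseries R :=
  \sum_(B : setcomp n | `[< setcomp_refines_star B A >]) ncM B.

End NCQSym.

Arguments ncM R {n} A.
Arguments ncqsym R n : clear implicits.
Arguments ncM_cut R {n} al rho.
Arguments ncF_cut R {n} al rho.
Arguments ncF R {n} A.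

Definition is_basis (R : pzRingType) (V : lmodType R) (U : set V)
    (I : finType) (b : I -> V) : Prop :=
  [/\ forall i, U (b i),
      forall c : I -> R, \sum_i c i *: b i = 0 -> forall i, c i = 0 &
      forall u, U u -> exists c : I -> R, u = \sum_i c i *: b i].

Definition Des (n : nat) (s : 'S_n) : {set 'I_n} :=
  [set k : 'I_n | [exists j : 'I_n, (j == k.+1 :> nat) && (s j < s k)%N]].

Definition stirling2 (n l : nat) : nat :=
  #|[set P : {set {set 'I_n}} | partition P [set: 'I_n] & #|P| == l]|.

Definition ordered_bell (n : nat) : nat :=
  (\sum_(1 <= l < n.+1) l`! * stirling2 n l)%N.

(* Main.v *)
(* For a set composition A, let word A list the blocks of A in order, each block
   increasingly: this is rho(A) in one-line notation, and A is recovered by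
   cutting word A into factors of lengths sz A.  Then B <=_* A holds exactly when
   word B = word A and sz B refines sz A, so the sum defining F_A runs over the
   compositions refining sz A.  If B <=_* A and B <> A then B has strictly more
   blocks than A, hence the F_A are unitriangular over the M_A; the latter are
   independent because x_{1..l}^A, with l the length of A, occurs in M_A and in no
   other M_B.  A word w is word A for one A per choice of cuts that includes all
   the descents of w, i.e., for 2^(number of ascents of w) set compositions. *)
Require Import Defs.
From mathcomp Require Import all_boot all_order all_algebra all_fingroup.
From mathcomp Require Import finmap.
From mathcomp Require Import boolp classical_sets functions cardinality fsbigop.
From mathcomp Require Import finset.

Set Implicit Arguments.
Unset Strict Implicit.
Unset Printing Implicit Defensive.

Import GRing.Theory.

(** * Set compositions as words with cuts, and their refinements *)

Lemma reshape_flatten (T : Type) (nss : seq (seq nat)) (w : seq T) :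
  size w = sumn (flatten nss) ->
  reshape (map sumn nss) w = map flatten (reshape (shape nss) (reshape (flatten nss) w)).
Proof.
move=> size_w; have sumn_nss : sumn (map sumn nss) = size w.
  rewrite size_w; elim: nss {size_w} => //= s nss ->.
  by rewrite sumn_cat.
have sh1 : shape (reshape (flatten nss) w) = flatten nss.
  by rewrite reshapeKl ?size_w.
have size1 : size (reshape (flatten nss) w) = sumn (shape nss).
  by rewrite size_reshape size_flatten.
apply: eq_from_flatten_shape.
  rewrite reshapeKr ?sumn_nss //.
  transitivity (flatten (flatten (reshape (shape nss) (reshape (flatten nss) w)))).
    by rewrite !reshapeKr ?size1 ?size_w.
  by move: (reshape _ (reshape _ _)); elim=> //= s ss IHs; rewrite flatten_cat IHs.
rewrite reshapeKl ?sumn_nss // /shape -map_comp.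
rewrite (eq_map (g := sumn \o map size)); last by move=> s /=; rewrite size_flatten.
by rewrite map_comp map_reshape (sh1 : map size _ = _) flattenK.
Qed.

Section Refinement.
Variable n : nat.
Implicit Types (A B : setcomp n) (al be : intcomp n) (rho : 'S_n).

Definition word A : seq 'I_n := flatten [seq enum X | X : {set 'I_n} <- blocks A].

Lemma one_line_rho_of A : one_line (rho_of A) = word A.
Proof. exact/singletons_refines_starP/rho_ofP. Qed.

Lemma rho_of_word A B : word A = word B -> rho_of A = rho_of B.
Proof. by rewrite -!one_line_rho_of => /one_line_inj. Qed.

Lemma set_enum_id (s : seq {set 'I_n}) :
  [seq [set x in t] | t : seq 'I_n <- [seq enum X | X : {set 'I_n} <- s]] = s.
Proof.
rewrite -map_comp -[RHS]map_id; apply: eq_map => X /=.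
by apply/setP => x; rewrite inE mem_enum.
Qed.

Lemma parts_sz A : parts (sz A) = shape [seq enum X | X : {set 'I_n} <- blocks A].
Proof. by rewrite /shape -map_comp; apply: eq_map => X /=; rewrite cardE. Qed.

Lemma reshape_sz_word A :
  reshape (parts (sz A)) (word A) = [seq enum X | X : {set 'I_n} <- blocks A].
Proof. by rewrite parts_sz flattenK. Qed.

Lemma cut_sz A : cut (sz A) (rho_of A) = A.
Proof. by apply: val_inj; rewrite /= one_line_rho_of reshape_sz_word set_enum_id. Qed.

Lemma sumn_parts al : sumn (parts al) = n.
Proof. by have /andP[_ /eqP] := intcompP al. Qed.

Lemma sz_cut al rho : sz (cut al rho) = al.
Proof.
apply: val_inj => /=; rewrite -map_comp.
have sz_line : size (one_line rho) = sumn (parts al) by rewrite sumn_parts size_one_line.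
(* A factor has as many elements as letters only if no letter repeats, which it inherits from the
   whole line. *)
have line_uniq : uniq (flatten (reshape (parts al) (one_line rho))).
  by rewrite reshapeKr ?sz_line // (perm_uniq (perm_one_line _)) enum_uniq.
rewrite -[RHS](@reshapeKl _ _ (one_line rho)) ?sz_line //.
apply/eq_in_map => t t_in /=; rewrite cardsE; apply/card_uniqP.
case/splitPr: t_in line_uniq => s1 s2.
by rewrite flatten_cat /= !cat_uniq => /and4P[_ _ + _].
Qed.

Lemma set0_blocks A : set0 \notin blocks A.
Proof. by have /and3P[] := setcompP A. Qed.

(** Comparing neighbouring sets is enough because the comparison is transitive through a nonempty
    middle set; this is why [set0] is excluded. *)
Lemma pairwise_flatten_lt (s : seq {set 'I_n}) :
  set0 \notin s ->
  sorted (fun X Y : {set 'I_n} => [forall x in X, forall y in Y, x < y]) s ->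
  pairwise (fun x y : 'I_n => x < y) (flatten [seq enum X | X : {set 'I_n} <- s]).
Proof.
move=> s0; rewrite (@sorted_pairwise_in _ (fun X => X != set0)).
- elim: s s0 => //= X s IHs; rewrite inE negb_or => /andP[_ /IHs {}IHs].
  case/andP=> /allP Xs /IHs {}IHs; rewrite pairwise_cat IHs.
  rewrite -sorted_pairwise ?sorted_enum_set ?andbT => [|? ? ?]; last exact: ltn_trans.
  apply/allrelP => x y xX /flatten_mapP[Y /Xs /forall_inP XY yY].
  rewrite !mem_enum in xX yY.
  by have /forall_inP/(_ y yY) := XY x xX.
- move=> Y X Z /set0Pn[y yY] _ _ /forall_inP XY /forall_inP YZ.
  apply/forall_inP => x xX; apply/forall_inP => z zZ.
  have /forall_inP/(_ _ yY) := XY _ xX; have /forall_inP/(_ _ zZ) := YZ _ yY.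
  by move=> yz /ltn_trans ->.
- by apply/allP => X Xs; apply: contraNneq s0 => <-.
Qed.

Lemma enum_bigcup_lt (s : seq {set 'I_n}) :
  set0 \notin s ->
  sorted (fun X Y : {set 'I_n} => [forall x in X, forall y in Y, x < y]) s ->
  enum (\bigcup_(X <- s) X) = flatten [seq enum X | X : {set 'I_n} <- s].
Proof.
move=> s0 /(pairwise_flatten_lt s0) s_lt.
apply: (@irr_sorted_eq _ (fun x y : 'I_n => x < y)).
- by move=> ? ? ?; exact: ltn_trans.
- by move=> x; exact: ltnn.
- exact: sorted_enum_set.
- by rewrite sorted_pairwise // => ? ? ?; exact: ltn_trans.
move=> x; rewrite mem_enum mem_bigcup_seq.
by apply/hasP/flatten_mapP => -[X Xs xX]; exists X; rewrite // ?mem_enum // -mem_enum.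
Qed.

(** The star condition only concerns consecutive blocks of [B]. Inside one block of [A] these
    comparisons chain, so listing that block increasingly lists its [B]-blocks one after the
    other. *)
Lemma refines_star_groups B A : setcomp_refines_star B A ->
  exists ss : seq (seq {set 'I_n}),
    [/\ flatten ss = blocks B, [seq \bigcup_(X <- s) X | s <- ss] = blocks A &
        {in ss, forall s, enum (\bigcup_(X <- s) X) = flatten [seq enum X | X : {set 'I_n} <- s]}].
Proof.
case=> -[ss ssB ssA] star; exists ss; split=> // s s_ss.
have sXA : \bigcup_(X <- s) X \in blocks A by rewrite -ssA map_f.
have [ss1 [ss2 ssE]] : exists ss1 ss2, ss = ss1 ++ s :: ss2.
  by case/splitPr: s_ss => ss1 ss2; exists ss1, ss2.
have BE : blocks B = flatten ss1 ++ s ++ flatten ss2 by rewrite -ssB ssE flatten_cat.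
(* The group [s] occupies the positions of [B] starting at [size (flatten ss1)], so neighbours in
   [s] are neighbours in [B]. *)
have nthB i : i < size s -> nth set0 B (size (flatten ss1) + i) = nth set0 s i.
  by move=> i_lt; rewrite BE nth_cat ltnNge leq_addr addKn nth_cat i_lt.
have sub_cup i : i < size s -> nth set0 s i \subset \bigcup_(X <- s) X.
  move=> i_lt; apply/fintype.subsetP => x xi; rewrite mem_bigcup_seq; apply/hasP.
  by exists (nth set0 s i); rewrite ?mem_nth.
apply: enum_bigcup_lt.
  have := set0_blocks B; apply: contra => s0.
  by rewrite BE !mem_cat s0 orbT.
apply/(sortedP set0) => i i_lt; have i_lt' := ltnW i_lt.
apply/forall_inP => x xi; apply/forall_inP => y yi.
apply: (star (size (flatten ss1) + i) _ _ sXA); rewrite -?addnS ?nthB ?sub_cup //.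
by rewrite BE !size_cat leq_add2l ltn_addr.
Qed.

Lemma refines_star_word B A : setcomp_refines_star B A -> word B = word A.
Proof.
case/refines_star_groups=> ss [ssB ssA ss_enum]; rewrite /word -ssB -ssA -map_comp.
elim: ss ss_enum {ssB ssA} => //= s ss IHss ss_enum.
rewrite map_cat flatten_cat IHss => [|t t_ss]; last by apply: ss_enum; rewrite inE t_ss orbT.
by rewrite ss_enum ?inE ?eqxx.
Qed.

Lemma refines_star_sz B A : setcomp_refines_star B A -> intcomp_refines (sz B) (sz A).
Proof.
case/refines_star_groups=> ss [ssB ssA ss_enum].
exists (map (map (fun X : {set 'I_n} => #|X|)) ss).
  by rewrite -map_flatten ssB.
rewrite /= -ssA -!map_comp; apply/eq_in_map => s s_ss /=.
rewrite cardE ss_enum // size_flatten /shape -map_comp.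
by congr sumn; apply: eq_map => X; rewrite /= cardE.
Qed.

(** Converse to the two preceding lemmas: additional cuts in [word A] split its blocks into
    consecutive factors, and these are in increasing order because each block is listed
    increasingly. *)
Lemma cut_refines_star be A :
  intcomp_refines be (sz A) -> setcomp_refines_star (cut be (rho_of A)) A.
Proof.
case=> nss nss_be nss_A.
have size_w : size (word A) = sumn (parts be).
  by rewrite sumn_parts -one_line_rho_of size_one_line.
have wE : flatten (reshape (parts be) (word A)) = word A by rewrite reshapeKr ?size_w.
(* Cutting the word finely by [be] and then gluing the factors in the groups given by [nss] is the
   same as cutting it by [sz A]. *)
have groupsE : [seq enum X | X : {set 'I_n} <- blocks A] =
    map flatten (reshape (shape nss) (reshape (parts be) (word A))).
  by rewrite -reshape_sz_word -nss_A -nss_be reshape_flatten // nss_be.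
have cutE : blocks (cut be (rho_of A)) =
    [seq [set x in t] | t : seq 'I_n <- reshape (parts be) (word A)].
  by rewrite /= one_line_rho_of.
split.
  exists (map (map (fun t : seq 'I_n => [set x in t]))
    (reshape (shape nss) (reshape (parts be) (word A)))).
    by rewrite -map_flatten reshapeKr // size_reshape -size_flatten nss_be.
  rewrite -[RHS]set_enum_id groupsE -!map_comp; apply: eq_map => tt /=.
  apply/setP => x; rewrite mem_bigcup_seq inE has_map.
  by apply/hasP/flattenP => -[t t_tt xt]; exists t; rewrite //= inE in xt *.
move=> j X; rewrite cutE size_map => j_lt XA.
set tt := reshape _ _ in wE j_lt *.
rewrite !(nth_map [::]) ?(ltnW j_lt) // => /fintype.subsetP jX /fintype.subsetP jX' x y xj yj.
have xX := jX _ xj; have yX := jX' _ yj; rewrite !inE in xj yj.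
(* The letter [x] lies in an earlier factor of [word A] than [y], and letters of a common block
   occur in the word in increasing order. *)
have := pairwise_flatten_enum A; rewrite -/(word A) -wE -(cat_take_drop j.+1 tt).
rewrite flatten_cat pairwise_cat => /and3P[/allrelP/(_ x y) + _ _].
have -> : x \in flatten (take j.+1 tt).
  apply/flattenP; exists (nth [::] tt j) => //.
  by rewrite -(nth_take [::] (ltnSn j)) mem_nth // size_takel // ltnW.
have -> : y \in flatten (drop j.+1 tt).
  apply/flattenP; exists (nth [::] tt j.+1) => //.
  by rewrite -[j.+1]addn0 -nth_drop addn0 mem_nth // size_drop subn_gt0.
by move=> /(_ isT isT) /allP/(_ X XA); rewrite xX yX.
Qed.

Lemma intcomp_refines_refl al : intcomp_refines al al.
Proof.
exists [seq [:: k] | k <- parts al]; first exact: flatten_seq1.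
by rewrite -map_comp -[RHS]map_id; apply: eq_map => k /=; rewrite addn0.
Qed.

Lemma refines_star_refl A : setcomp_refines_star A A.
Proof.
rewrite -[X in setcomp_refines_star X _]cut_sz.
exact/cut_refines_star/intcomp_refines_refl.
Qed.

(** No group of blocks of [B] is empty, since its union is a block of [A]. Equal lengths would thus
    make every group a single block, forcing [A = B]. *)
Lemma refines_size B A :
  setcomp_refines B A -> A != B -> size (blocks A) < size (blocks B).
Proof.
case=> ss ssB ssA; rewrite -[A == B]/(blocks A == blocks B) -ssA -ssB size_map.
have : [::] \notin ss.
  have := set0_blocks A; apply: contra; rewrite -ssA => ss0.
  by apply/mapP; exists [::]; rewrite ?big_nil.
elim: ss {ssA ssB} => [|s ss IHss] //=.
rewrite inE negb_or => /andP[s0 /IHss {}IHss].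
(* The induction hypothesis speaks only of differing tails; tails that agree have equal sizes. *)
have le_ss : size ss <= size (flatten ss).
  have [/(congr1 size)|/IHss/ltnW //] := eqVneq [seq \bigcup_(X <- t) X | t <- ss] (flatten ss).
  by rewrite size_map => ->.
case: s s0 => [|X [|Y s]] //= _; last first.
  by move=> _; rewrite !ltnS size_cat (leq_trans le_ss) ?leq_addl.
by rewrite big_seq1 eqseq_cons eqxx /= => /IHss; rewrite ltnS.
Qed.

End Refinement.

(** * Unitriangular families over a free family *)

Section Unitriangular.
Local Open Scope ring_scope.
Variables (R : pzRingType) (V : lmodType R) (I : finType).
Variables (r : rel I) (d : I -> nat) (b f : I -> V).
Hypothesis r_refl : reflexive r.
Hypothesis r_d : forall i j, r i j -> j != i -> (d j < d i)%N.
Hypothesis fE : forall j, f j = \sum_(i | r i j) b i.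

Let in_span (g : I -> V) (u : V) := exists c : I -> R, u = \sum_i c i *: g i.

Lemma span_sum (g : I -> V) (J : finType) (P : pred J) (c : J -> R) (u : J -> V) :
  (forall j, P j -> in_span g (u j)) -> in_span g (\sum_(j | P j) c j *: u j).
Proof.
move=> u_span; have [a aE] : {a : J -> I -> R & forall j, P j -> u j = \sum_i a j i *: g i}.
  apply: (choice (P := fun j a => P j -> u j = \sum_i a i *: g i)) => j.
  have [/u_span[a ->]|] := boolP (P j); first by exists a.
  by exists (fun=> 0).
exists (fun i => \sum_(j | P j) c j * a j i).
rewrite (eq_bigr (fun j => \sum_i (c j * a j i) *: g i)) => [|j /aE ->].
  by rewrite exchange_big; apply: eq_bigr => i _; rewrite scaler_suml.
by rewrite scaler_sumr; apply: eq_bigr => i _; rewrite scalerA.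
Qed.

Lemma mem_span (g : I -> V) (i : I) : in_span g (g i).
Proof.
exists (fun j => (j == i)%:R); rewrite (bigD1 i) //= eqxx scale1r big1 ?addr0 // => j.
by move=> /negPf ->; rewrite scale0r.
Qed.

(** Solving [fE] for its diagonal term writes [b i] as [f i] minus vectors [b j] with [d j > d i],
    so induction on the distance of [d i] from the maximum applies. *)
Lemma unitriangular_span (i : I) : in_span f (b i).
Proof.
have d_le j : (d j <= \max_j d j)%N by exact: leq_bigmax.
have [m] := ubnP (\max_j d j - d i)%N; elim: m i => // m IHm i m_gt.
(* The difference is written as a sum over [bool] so that [span_sum] covers it. *)
have -> : b i = \sum_(j : bool) (if j then 1 else -1) *:
    (if j then f i else \sum_(j | r j i && (j != i)) 1 *: b j).
  rewrite big_bool /= scale1r scaleN1r fE (bigD1 i) ?r_refl //=.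
  by under [in X in _ = _ - X]eq_bigr do rewrite scale1r; rewrite addrK.
apply: span_sum => -[] _; first exact: mem_span.
apply: span_sum => j /andP[rji j_i]; apply: IHm.
have lt_d : (d i < d j)%N by rewrite r_d // eq_sym.
by rewrite -ltnS (leq_trans _ m_gt) // ltnS ltn_sub2l // (leq_trans lt_d).
Qed.

Lemma unitriangular_basis :
  (forall c : I -> R, \sum_i c i *: b i = 0 -> forall i, c i = 0) ->
  is_basis [set u | in_span b u]%classic f.
Proof.
move=> b_free; split.
- move=> j; rewrite /= fE.
  have -> : \sum_(i | r i j) b i = \sum_(i | r i j) 1 *: b i.
    by apply: eq_bigr => i _; rewrite scale1r.
  by apply: span_sum => i _; exact: mem_span.
(* After exchanging the sums, this is the coefficient of [b i] in the given relation. *)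
- move=> c cf0; have c0 i : \sum_(j | r i j) c j = 0.
    apply: (b_free (fun i => \sum_(j | r i j) c j)); rewrite -[RHS]cf0.
    under eq_bigr do rewrite scaler_suml.
    rewrite (exchange_big_dep predT) //=; apply: eq_bigr => j _.
    by rewrite fE scaler_sumr.
  (* The other indices [j] in this sum have smaller [d], so their coefficients already vanish and
     [c i] alone remains. *)
  move=> i; have [m] := ubnP (d i); elim: m i => // m IHm i m_gt.
  have := c0 i; rewrite (bigD1 i) ?r_refl //= big1 ?addr0 // => j /andP[rij j_i].
  by apply: IHm; rewrite -ltnS (leq_trans _ m_gt) // ltnS r_d.
- move=> u [c ->]; apply: span_sum => i _; exact: unitriangular_span.
Qed.

End Unitriangular.

(** * Linear independence of the monomial functions *)

Section Monomials.
Variable n : nat.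
Implicit Types A B : setcomp n.

Definition block_index A (k : 'I_n) : nat := find (fun X : {set 'I_n} => k \in X) (blocks A).

Lemma block_index_lt A k : block_index A k < size (blocks A).
Proof.
rewrite -has_find -mem_bigcup_seq; have /and3P[_ _ /eqP ->] := setcompP A.
by rewrite inE.
Qed.

Lemma mem_block_index A k : k \in nth set0 (blocks A) (block_index A k).
Proof.
by apply: (@nth_find _ set0 (fun X : {set 'I_n} => k \in X)); rewrite has_find block_index_lt.
Qed.

Lemma nth_blocks A j : j < size (blocks A) ->
  nth set0 (blocks A) j = [set k | block_index A k == j].
Proof.
move=> j_lt; have /and3P[_ A_disj _] := setcompP A.
apply/setP => k; rewrite inE; apply/idP/eqP => [kj|<-]; last exact: mem_block_index.
have idx_lt := block_index_lt A k; have k_idx := mem_block_index A k.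
case: (ltngtP (block_index A k) j) => // lt_ij.
- by have /disjointFr/(_ k_idx) := pairwiseP set0 A_disj _ _ idx_lt j_lt lt_ij; rewrite kj.
- by have /disjointFr/(_ kj) := pairwiseP set0 A_disj _ _ j_lt idx_lt lt_ij; rewrite k_idx.
Qed.

Lemma block_index_inj A B :
  size (blocks A) = size (blocks B) -> block_index A =1 block_index B -> A = B.
Proof.
move=> sizeAB AB; apply: val_inj; apply: (@eq_from_nth _ set0) => // j j_lt.
rewrite !nth_blocks -?sizeAB //.
by apply/setP => k; rewrite !inE AB.
Qed.

Definition initial_fset (l : nat) : {fset nat} := [fset j in iota 0 l]%fset.

Lemma card_initial_fset l : #|` initial_fset l| = l.
Proof. by rewrite card_fseq undup_id ?iota_uniq ?size_iota. Qed.

Lemma sort_initial_fset l : sort leq (enum_fset (initial_fset l)) = iota 0 l.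
Proof.
apply: (sorted_eq leq_trans anti_leq).
- exact/sort_sorted/leq_total.
- exact: iota_sorted.
rewrite perm_sort; apply: uniq_perm; rewrite ?iota_uniq ?fset_uniq // => j.
by rewrite -[LHS]/(j \in initial_fset l) in_fset.
Qed.

(** The letters of the word determine [I], hence the number of blocks. For an initial set [I] the
    letter at position [k] is the index of the block containing [k], so the word also determines the
    blocks. *)
Lemma ncmonomial_initial A B (I : {fset nat}) :
  #|` I| = size (blocks B) -> ncmonomial B I = ncmonomial A (initial_fset (size (blocks A))) ->
  B = A /\ I = initial_fset (size (blocks A)).
Proof.
move=> I_size BA; have I_init : I = initial_fset (size (blocks A)).
  apply/fsetP => j; rewrite -(mem_ncmonomial I_size) BA.
  by rewrite mem_ncmonomial ?card_initial_fset.
have sizeBA : size (blocks B) = size (blocks A) by rewrite -I_size I_init card_initial_fset.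
split=> //; apply: block_index_inj => // k.
move: BA; rewrite I_init /ncmonomial sort_initial_fset => /eq_in_map/(_ k).
rewrite -!/(block_index _ _) !nth_iota -?sizeBA ?block_index_lt //; last first.
  by rewrite sizeBA block_index_lt.
by rewrite !add0n mem_enum; apply.
Qed.

Local Open Scope ring_scope.

(** Taking coefficients at these words gives functionals dual to the family [ncM], which is what
    makes it free. *)
Lemma ncM_initial (R : comPzRingType) A B :
  ncM R B (ncmonomial A (initial_fset (size (blocks A)))) = (B == A)%:R.
Proof.
rewrite /ncM; set w := ncmonomial _ _.
have [->|BA] := eqVneq B A; last first.
  rewrite fsbig1 // => I I_size; case: eqP => // /(ncmonomial_initial I_size)[BA' _].
  by rewrite BA' eqxx in BA.
(* By [ncmonomial_initial], the initial set is the only one that contributes. *)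
rewrite (fsbigE [:: initial_fset (size (blocks A))]) //=.
- rewrite big_mkcond big_seq1 ifT ?eqxx //; apply/mem_set; exact: card_initial_fset.
- by move=> I; rewrite /= inE => /eqP ->; exact: card_initial_fset.
move=> I I_size I_neq; case: (ncmonomial A I =P w) => // /(ncmonomial_initial I_size)[_ IE].
by rewrite inE IE eqxx in I_neq.
Qed.

Lemma ncM_free (R : comPzRingType) (c : setcomp n -> R) :
  \sum_A c A *: ncM R A = 0 -> forall A, c A = 0.
Proof.
move=> c0 A; have := congr1 (fun f => f (ncmonomial A (initial_fset (size (blocks A))))) c0.
rewrite /= fct_sumE (bigD1 A) //= big1 => [|B BA]; rewrite scalrfctE ncM_initial.
  by rewrite eqxx addr0 /GRing.scale /= mulr1.
by rewrite (negPf BA) scaler0.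
Qed.

End Monomials.

(** * The fundamental basis *)

Section Basis.
Local Open Scope ring_scope.
Variables (R : comPzRingType) (n : nat).

Lemma ncF_basis : is_basis (ncqsym R n) (fun A : setcomp n => ncF R A).
Proof.
apply: (@unitriangular_basis _ _ _
  (fun B A => `[< setcomp_refines_star B A >]) (fun A => size (blocks A)) (ncM R)).
- by move=> A; apply/asboolP/refines_star_refl.
- by move=> B A /asboolP[BA _]; exact: refines_size.
- by [].
- exact: ncM_free.
Qed.

(** The two sums match under [be] mapping to [cut be (rho_of A)], with inverse [sz]: any [B] below
    [A] has the same word as [A] and is the cut of it by [sz B]. *)
Lemma ncF_cutE (A : setcomp n) : ncF R A = ncF_cut R (sz A) (rho_of A).
Proof.
rewrite /ncF /ncF_cut (reindex_onto (fun be => cut be (rho_of A)) (@sz n)) /=.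
  apply: eq_bigl => be; rewrite sz_cut eqxx andbT.
  apply/asboolP/asboolP => [/refines_star_sz|/cut_refines_star //].
  by rewrite sz_cut.
move=> B /asboolP/refines_star_word/rho_of_word <-; exact: cut_sz.
Qed.

(** Equal members at distinct indices would give a linear relation with coefficient 1 at [A]. Over
    the zero ring all series coincide, whence the hypothesis. *)
Lemma ncF_inj : 1 != 0 :> R -> injective (fun A : setcomp n => ncF R A).
Proof.
move=> R_nt A B AB; have [//|neqAB] := eqVneq A B.
have [_ F_free _] := ncF_basis.
have := F_free (fun C => (C == A)%:R - (C == B)%:R).
under eq_bigr do rewrite scalerBl.
rewrite sumrB (bigD1 A) // [X in _ - X](bigD1 B) //= !eqxx !scale1r AB.
rewrite !big1 => [|C /negPf ->|C /negPf ->]; rewrite ?scale0r //.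
move=> /(_ (subrr _) A); rewrite eqxx (negPf neqAB) subr0 => /eqP.
by rewrite (negPf R_nt).
Qed.

End Basis.

(** * Splittings of a word into sorted factors *)

Section SortedSplits.
Variables (T : eqType) (r : rel T).

(* The splittings of x :: s into nonempty r-sorted factors. *)
Fixpoint cons_splits (x : T) (s : seq T) : seq (seq (seq T)) :=
  if s is y :: s' then
    let ts := cons_splits y s' in
    [seq [:: x] :: ss | ss <- ts] ++
    (if r x y then [seq (x :: head [::] ss) :: behead ss | ss <- ts] else [::])
  else [:: [:: [:: x]]].

Definition sorted_splits (w : seq T) : seq (seq (seq T)) :=
  if w is x :: s then cons_splits x s else [:: [::]].

Lemma head_cons_splits x s ss :
  ss \in cons_splits x s -> exists t ss', ss = (x :: t) :: ss'.
Proof.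
elim: s x ss => [|y s IHs] x ss; first by rewrite inE => /eqP ->; exists [::], [::].
rewrite mem_cat => /orP[/mapP[ss' _ ->]|]; first by exists [::], ss'.
by case: ifP => // _ /mapP[ss' _ ->]; exists (head [::] ss'), (behead ss').
Qed.

Lemma mem_cons_splits x s ss :
  (ss \in cons_splits x s) = [&& flatten ss == x :: s, [::] \notin ss & all (sorted r) ss].
Proof.
elim: s x ss => [|y s IHs] x ss.
  rewrite inE; apply/eqP/and3P => [->|] //.
  by case: ss => [|[|a [|b t]] [|[|c u] ss]] [] //= /eqP [->].
have hd := @head_cons_splits y s.
(* An empty splitting or an empty first factor is impossible; a first factor with one letter comes
   from a cut after [x], a longer one from gluing [x] to the next factor. *)
rewrite /= mem_cat; case: ss => [|[|a [|b t]] ss].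
- rewrite [RHS](_ : _ = false) //; apply/negP => /orP[/mapP[]|] //.
  by case: ifP => // _ /mapP[].
- rewrite [RHS](_ : _ = false) ?inE ?andbF //; apply/negP => /orP[/mapP[]|] //.
  by case: ifP => // _ /mapP[].
- have -> : ([:: a] :: ss \in
      (if r x y then [seq (x :: head [::] ss) :: behead ss | ss <- cons_splits y s]
       else [::])) = false.
    case: ifP => // _; apply/negP => /mapP[ss' /hd[t [ss'' ->]]] /=.
    by case.
  rewrite orbF /= eqseq_cons.
  apply/mapP/and3P => [[ss' ss'_in [-> ->]]|[/andP[/eqP -> flat] nil_ss srt]].
    by move: ss'_in; rewrite IHs => /and3P[-> + ->]; rewrite eqxx inE.
  exists ss => //; rewrite IHs flat srt andbT.
  by move: nil_ss; rewrite inE.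
have -> : ((a :: b :: t) :: ss \in [seq [:: x] :: ss0 | ss0 <- cons_splits y s]) = false.
  by apply/negP => /mapP[].
case: ifP => [rxy|nrxy] /=; last first.
  rewrite !eqseq_cons; apply/esym/negP => /and3P[/and3P[/eqP-> /eqP-> _] _ /andP[]].
  by rewrite nrxy.
rewrite !eqseq_cons; apply/mapP/and3P =>
  [[ss' ss'_in]|[/and3P[/eqP -> /eqP by_ flat] nil_ss /andP[srt srts]]].
  case: (hd _ ss'_in) => u [ss'' E]; move: ss'_in; rewrite E /= => + [-> -> -> ->].
  rewrite IHs /= !eqseq_cons !inE => /and3P[/andP[_ ->] -> /andP[-> ->]].
  by rewrite !eqxx rxy.
exists ((b :: t) :: ss) => //; rewrite IHs /= eqseq_cons by_ eqxx flat srts.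
by move: nil_ss srt; rewrite !inE /= => -> /andP[_ srt]; rewrite -by_ srt.
Qed.

Lemma cons_splits_uniq x s : uniq (cons_splits x s).
Proof.
elim: s x => //= y s IHs x.
have hd := @head_cons_splits y s.
rewrite cat_uniq map_inj_uniq ?IHs => [|? ? []//] /=; case: ifP => //= _.
apply/andP; split.
  by apply/hasPn => _ /mapP[ss' /hd[t [ss'' ->]] ->] /=; apply/negP => /mapP[].
rewrite map_inj_in_uniq // => ss1 ss2 /hd[t1 [u1 ->]] /hd[t2 [u2 ->]] /=.
by case=> -> ->.
Qed.

(** Two neighbours related by [r] may be separated or not, which doubles the count; other neighbours
    must be separated. *)
Lemma size_cons_splits x s : size (cons_splits x s) = 2 ^ count id (pairmap r x s).
Proof.
elim: s x => //= y s IHs x; rewrite size_cat size_map IHs.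
by case: (r x y); rewrite ?size_map ?IHs /= ?addn0 // expnS mul2n -addnn.
Qed.

Lemma mem_sorted_splits w ss :
  (ss \in sorted_splits w) = [&& flatten ss == w, [::] \notin ss & all (sorted r) ss].
Proof.
case: w => [|x s]; last exact: mem_cons_splits.
by case: ss => [|[|a t] ss]; rewrite !inE ?andbF.
Qed.

Lemma sorted_splits_uniq w : uniq (sorted_splits w).
Proof. by case: w => // x s; exact: cons_splits_uniq. Qed.

Lemma size_sorted_splits w :
  size (sorted_splits w) = 2 ^ count id (if w is x :: s then pairmap r x s else [::]).
Proof. by case: w => // x s; exact: size_cons_splits. Qed.

Lemma count_pairmap (x0 x : T) s :
  count id (pairmap r x s) = \sum_(i < size s) r (nth x0 (x :: s) i) (nth x0 s i).
Proof.
elim: s x => [|y s IHs] x /=; first by rewrite big_ord0.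
by rewrite big_ord_recl /= IHs.
Qed.

End SortedSplits.

(** * Classes of set compositions indexed by permutations *)

Section Counting.
Variable n : nat.
Implicit Types (A B : setcomp n) (s : 'S_n).

Lemma enum_set_sorted (t : seq 'I_n) :
  sorted (fun x y : 'I_n => x < y) t -> enum [set x in t] = t.
Proof.
move=> t_sorted; apply: (@irr_sorted_eq _ (fun x y : 'I_n => x < y)) => //.
- by move=> ? ? ?; exact: ltn_trans.
- by move=> x; exact: ltnn.
- exact: sorted_enum_set.
by move=> x; rewrite mem_enum inE.
Qed.

(** Listing each block increasingly is a bijection from the set compositions with word [w] to the
    sorted splittings of [w]; its inverse takes the underlying sets of the factors. *)
Lemma card_setcomp_word (w : seq 'I_n) : perm_eq w (enum 'I_n) ->
  #|[set A : setcomp n | word A == w]| = size (sorted_splits (fun x y : 'I_n => x < y) w).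
Proof.
move=> w_perm; pose lists A := [seq enum X | X : {set 'I_n} <- blocks A].
have lists_inj : injective lists.
  by move=> A B AB; apply: val_inj; rewrite -[LHS]set_enum_id -[RHS]set_enum_id [X in map _ X]AB.
rewrite cardE -(size_map lists); apply/perm_size/uniq_perm.
- by rewrite map_inj_uniq ?enum_uniq.
- exact: sorted_splits_uniq.
move=> ss; rewrite mem_sorted_splits.
apply/mapP/and3P => [[A + ->]|[/eqP ss_w ss0 /allP ss_sorted]].
  rewrite mem_enum inE => wA; split=> //.
    apply: contra (set0_blocks A) => /mapP[X XA /esym X0].
    suff <- : X = set0 by [].
    by apply/setP => x; rewrite -mem_enum X0 inE.
  by apply/allP => _ /mapP[X _ ->]; exact: sorted_enum_set.
have ss_perm : perm_eq (flatten ss) (enum 'I_n) by rewrite ss_w.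
have listsE : lists (SetComp (is_setcomp_flatten ss0 ss_perm)) = ss.
  rewrite /lists /= -map_comp -[RHS]map_id; apply/eq_in_map => t t_ss /=.
  by rewrite enum_set_sorted ?ss_sorted.
exists (SetComp (is_setcomp_flatten ss0 ss_perm)) => //.
by rewrite mem_enum inE /word -/(lists _) listsE ss_w.
Qed.

Lemma perm_rev_ord (w : seq 'I_n) :
  perm_eq w (enum 'I_n) -> perm_eq (map (@rev_ord n) w) (enum 'I_n).
Proof.
move=> w_perm; apply: uniq_perm; rewrite ?enum_uniq //.
  by rewrite (map_inj_uniq rev_ord_inj) (perm_uniq w_perm) enum_uniq.
move=> x; rewrite mem_enum -[x]rev_ordK map_f //.
by rewrite (perm_mem w_perm) mem_enum.
Qed.

(* Reversing the values turns the descents of s, which are to be free cuts, into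
   ascents of the word. *)
Definition descent_class s : {set setcomp n} :=
  [set A | word A == map (@rev_ord n) (one_line s)].

Lemma descent_class_disjoint s t : s != t -> [disjoint descent_class s & descent_class t].
Proof.
move=> st; apply/pred0P => A /=; rewrite !inE; apply/negP => /andP[/eqP ->].
by move/eqP/(inj_map rev_ord_inj)/one_line_inj => E; rewrite E eqxx in st.
Qed.

Lemma bigcup_descent_class : \bigcup_(s : 'S_n) descent_class s = [set: setcomp n].
Proof.
apply/setP => A; rewrite inE; apply/bigcupP.
have [s sE] := one_line_onto (perm_rev_ord (perm_flatten_enum A)).
exists s => //; rewrite inE sE -map_comp.
by apply/eqP; rewrite -[LHS]map_id; apply: eq_map => x; rewrite /= rev_ordK.
Qed.

End Counting.

Lemma card_Des n (s : 'S_n.+1) :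
  #|Des s| = \sum_(i < n) (s (inord i.+1) < s (inord i)).
Proof.
(* The last index has no successor, so it is never a descent and its term is 0. *)
rewrite -sum1_card big_mkcond big_ord_recr /= [X in _ + X]ifF ?addn0; last first.
  rewrite inE; apply/existsP => -[j /andP[/eqP jE _]].
  by have := ltn_ord j; rewrite jE ltnn.
apply: eq_bigr => i _.
have i_E : widen_ord (leqnSn n) i = inord i.
  by apply: val_inj; rewrite /= inordK // ltnS ltnW.
rewrite inE; set b := [exists j, _]; suff -> : b = (s (inord i.+1) < s (inord i)).
  by case: (_ < _).
rewrite -i_E; apply/existsP/idP => [[j /andP[/eqP jE]]|lt_s].
  by rewrite (_ : inord i.+1 = j) //; apply: val_inj; rewrite /= jE inordK // -jE.
by exists (inord i.+1); rewrite lt_s inordK ?eqxx // ltnS.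
Qed.

Lemma card_descent_class n (s : 'S_n) : #|descent_class s| = 2 ^ #|Des s|.
Proof.
rewrite card_setcomp_word ?perm_rev_ord ?perm_one_line // size_sorted_splits; congr (2 ^ _).
case: n s => [|n] s.
  rewrite (size0nil (size_one_line s)) /=; apply/esym/eqP; rewrite cards_eq0.
  by apply/eqP/setP => -[].
have nth_w (i : nat) : i <= n ->
    nth ord0 (map (@rev_ord n.+1) (one_line s)) i = rev_ord (s (inord i)).
  move=> i_le; rewrite (nth_map ord0) ?size_one_line // (nth_map ord0) ?size_enum_ord //.
  by congr (rev_ord (s _)); apply: val_inj; rewrite /= nth_enum_ord // inordK.
have size_w : size (map (@rev_ord n.+1) (one_line s)) = n.+1.
  by rewrite size_map size_one_line.
rewrite card_Des; case: (map _ _) nth_w size_w => // x w nth_w [size_w].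
rewrite (count_pairmap _ ord0) size_w; apply: eq_bigr => i _.
(* Position [i] of the tail is position [i.+1] of the word; [rev_ord] reverses the inequality
   between the two values of [s]. *)
rewrite -[nth _ w i]/(nth ord0 (x :: w) i.+1) !nth_w //; last exact: ltnW.
by rewrite /= ltn_sub2lE.
Qed.

(** * Ordered Bell numbers count set compositions *)

Section OrderedBell.
Variable n : nat.
Implicit Types (A : setcomp n) (Q : {set {set 'I_n}}).

Lemma blocks_eq A (X Y : {set 'I_n}) k :
  X \in blocks A -> Y \in blocks A -> k \in X -> k \in Y -> X = Y.
Proof.
move=> /(nthP set0)[i i_lt <-] /(nthP set0)[j j_lt <-].
by rewrite !nth_blocks // !inE => /eqP -> /eqP ->.
Qed.

Lemma uniq_blocks A : uniq (blocks A).
Proof.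
have /and3P[A0 + _] := setcompP A; rewrite uniq_pairwise.
apply: (sub_in_pairwise (P := [pred X | X != set0])).
  move=> X Y X0 _ XY; apply: contraNneq X0 => XYE.
  by move: XY; rewrite -XYE -setI_eq0 setIid.
by apply/allP => X XA /=; apply: contraNneq A0 => <-.
Qed.

Definition block_set A : {set {set 'I_n}} := [set X in blocks A].

Lemma partition_block_set A : partition (block_set A) [set: 'I_n].
Proof.
apply/and3P; split.
- apply/eqP/setP => k; rewrite inE; apply/bigcupP.
  exists (nth set0 (blocks A) (block_index A k)); last exact: mem_block_index.
  by rewrite inE mem_nth ?block_index_lt.
- apply/trivIsetP => X Y; rewrite !inE => XA YA XY.
  apply/pred0P => k /=; apply/negP => /andP[kX kY].
  by rewrite (blocks_eq XA YA kX kY) eqxx in XY.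
- by rewrite inE set0_blocks.
Qed.

(** A set composition with underlying partition [Q] is an ordering of [Q], that is, a permutation of
    the list [enum Q]. *)
Lemma card_block_set_fiber Q : partition Q [set: 'I_n] ->
  #|[set A | block_set A == Q]| = (#|Q|)`!.
Proof.
move=> Q_part; have /and3P[/eqP Q_cov /trivIsetP Q_triv Q0] := Q_part.
rewrite [in RHS]cardE -size_permutations ?enum_uniq //.
rewrite cardE -(size_map (@blocks n)); apply/perm_size/uniq_perm.
- by rewrite map_inj_uniq ?enum_uniq //; exact: val_inj.
- exact: permutations_uniq.
move=> t; rewrite mem_permutations; apply/mapP/idP => [[A + ->]|t_perm].
  rewrite mem_enum inE => /eqP AQ; apply: uniq_perm; rewrite ?uniq_blocks ?enum_uniq //.
  by move=> X; rewrite mem_enum -AQ inE.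
have memQ X : (X \in t) = (X \in Q) by rewrite (perm_mem t_perm) mem_enum.
have t_comp : is_setcomp t.
  apply/and3P; split; first by rewrite memQ.
    have : pairwise (fun X Y => X != Y) t by rewrite -uniq_pairwise (perm_uniq t_perm) enum_uniq.
    apply: (sub_in_pairwise (P := [in Q])) => [X Y XQ YQ|]; first exact: Q_triv.
    by apply/allP => X; rewrite memQ.
  by rewrite -Q_cov /cover (perm_big _ t_perm) big_enum.
exists (SetComp t_comp) => //; rewrite mem_enum inE.
by apply/eqP/setP => X; rewrite inE memQ.
Qed.

Lemma card_setcomp_bell : 0 < n -> #|{: setcomp n}| = ordered_bell n.
Proof.
move=> n_gt0; rewrite -sum1_card.
rewrite (partition_big block_set (fun Q => partition Q [set: 'I_n])) /=; last first.
  by move=> A _; exact: partition_block_set.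
rewrite /ordered_bell.
(* Each product of a factorial and a Stirling number becomes a sum over all partitions, so that the
   sums can be exchanged and each partition meets exactly one [l]. *)
rewrite (eq_bigr (fun l => \sum_(Q | partition Q [set: 'I_n]) if #|Q| == l then l`! else 0)).
  rewrite exchange_big; apply: eq_bigr => Q Q_part.
  rewrite -big_mkcond (eq_bigl (fun l => l == #|Q|)) => [|l]; last exact: eq_sym.
  rewrite big_nat1_eq ltnS.
  (* The sum over [l] starts at 1, so [Q] must have a block; this is where [n > 0] enters. *)
  have Q_le : 0 < #|Q| <= n.
    have [QT Q0] : #|[set: 'I_n]| = n /\ set0 \notin Q.
      by rewrite cardsT card_ord; case/and3P: Q_part.
    apply/andP; split.
      rewrite card_gt0; apply: contraTneq Q_part => ->; apply/negP => /and3P[/eqP + _ _].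
      by rewrite /cover big_set0 => E; move: n_gt0; rewrite -QT -E cards0.
    rewrite -[leqRHS]QT (card_partition Q_part) -sum1_card leq_sum // => X XQ.
    by rewrite card_gt0; apply: contraNneq Q0 => <-.
  rewrite Q_le -card_block_set_fiber // -sum1_card.
  by apply: eq_bigl => A; rewrite inE.
move=> l _; rewrite -big_mkcondr /= sum_nat_cond_const mulnC /stirling2.
by congr (_ * _); apply: eq_card => Q; rewrite !inE.
Qed.

End OrderedBell.

(** * The ordered Bell identity and the resulting bound *)

Lemma card_setcomp_Des n : #|{: setcomp n}| = \sum_(s : 'S_n) 2 ^ #|Des s|.
Proof.
rewrite -cardsT -bigcup_descent_class -sum1_card.
rewrite partition_disjoint_bigcup; last by move=> s t; exact: descent_class_disjoint.
by apply: eq_bigr => s _; rewrite sum1_card card_descent_class.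
Qed.

Lemma card_Des_le n (s : 'S_n) : #|Des s| <= n.-1.
Proof.
case: n s => [|n] s; first by rewrite (leq_trans (max_card _)) ?card_ord.
rewrite card_Des -[leqRHS]card_ord -sum1_card leq_sum // => i _; exact: leq_b1.
Qed.

Lemma Des1 n : Des (1 : 'S_n)%g = set0.
Proof.
apply/setP => k; rewrite !inE; apply/existsP => -[j /andP[/eqP jE]].
by rewrite !perm1 jE ltnNge leqnSn.
Qed.

(** Each term is at most [2 ^ n.-1]. The identity has no descents, so for [n > 1] its term 1 is
    strictly smaller than that; for [n <= 1] all terms equal 1. *)
Lemma sum_Des_le n : \sum_(s : 'S_n) 2 ^ #|Des s| <= 2 ^ n.-1 * n`! ?= iff (n <= 1).
Proof.
have -> : 2 ^ n.-1 * n`! = \sum_(s : 'S_n) 2 ^ n.-1.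
  by rewrite sum_nat_const card_Sn mulnC.
split; first by apply: leq_sum => s _; rewrite leq_exp2l ?card_Des_le.
have [n_le1|n_gt1] := leqP n 1.
  apply/eqP/eq_bigr => s _; congr (2 ^ _); apply/eqP.
  have := card_Des_le s; by case: n n_le1 s => [|[]] // _ s; rewrite leqn0.
apply/negbTE; rewrite neq_ltn (bigD1 1%g) //= [X in _ < X](bigD1 1%g) //=.
rewrite -addSn leq_add //.
  by rewrite Des1 cards0 -[1]/(2 ^ 0) ltn_exp2l // -subn1 subn_gt0.
by apply: leq_sum => s _; rewrite leq_exp2l ?card_Des_le.
Qed.

Theorem proposition4p27 (R : comPzRingType) (n : nat) :
  [/\ (forall A : setcomp n, ncF R A = ncF_cut R (sz A) (rho_of A)),
      is_basis (ncqsym R n) (fun A : setcomp n => ncF R A),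
      (1%R != 0%R :> R -> injective (fun A : setcomp n => ncF R A)) /\
      (exists P : 'S_n -> {set setcomp n},
        [/\ forall s t : 'S_n, s != t -> [disjoint P s & P t],
            \bigcup_(s : 'S_n) P s = [set: setcomp n] &
            forall s : 'S_n, #|P s| = 2 ^ #|Des s|]),
      (0 < n -> ordered_bell n = \sum_(s : 'S_n) 2 ^ #|Des s|) &
      (0 < n -> ordered_bell n <= 2 ^ n.-1 * n`!) /\
      (1 < n -> ordered_bell n < 2 ^ n.-1 * n`!)].
Proof.
have bellE : 0 < n -> ordered_bell n = \sum_(s : 'S_n) 2 ^ #|Des s|.
  by move=> n_gt0; rewrite -card_setcomp_bell // card_setcomp_Des.
split=> //; first exact: ncF_cutE.
- exact: ncF_basis.
- split; first exact: ncF_inj.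
  exists (@descent_class n); split; first exact: descent_class_disjoint.
    exact: bigcup_descent_class.
  exact: card_descent_class.
- split=> n_gt; rewrite bellE ?(ltnW n_gt) //.
    exact: sum_Des_le.
  by rewrite (ltn_leqif (sum_Des_le n)) -ltnNge.
Qed.
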